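(* Let $L>0$, let $f:\mathbb{R}^n\to\mathbb{R}$ be a convex $L$-smooth function, and let $\{x_k\}_{k=0}^{\infty}$ be the sequence of iterates produced by gradient descent, i.e. $x_k=x_{k-1}-\eta\nabla f(x_{k-1})$ for all $k\ge 1$, starting from some $x_0\in\mathbb{R}^n$, using a constant step size $\eta\in\left(0,\frac{1.75}{L}\right]$. Then the mapping $k\mapsto f(x_k)$ is convex over $\mathbb{Z}_{\ge 0}$ (equivalently, the sequence $\{f(x_k)-f(x_{k+1})\}_{k=0}^{\infty}$ is non-increasing).
   Context: A function $f:\mathbb{R}^n\to\mathbb{R}$ is $L$-smooth if it is differentiable and its gradient is $L$-Lipschitz with respect to the Euclidean norm: $\|\nabla f(x)-\nabla f(y)\|\le L\|x-y\|$ for all $x,y\in\mathbb{R}^n$. For a real sequence $\{a_k\}_{k=0}^{\infty}$, the mapping $k\mapsto a_k$ is said to be convex over $\mathbb{Z}_{\ge 0}$ if the function $g:[0,\infty)\to\mathbb{R}$ defined by $g(t)=a_{\lfloor t\rfloor}+(t-\lfloor t\rfloor)(a_{\lfloor t\rfloor+1}-a_{\lfloor t\rfloor})$ (the linear interpolation of the points $(k,a_k)$) is convex. This is equivalent to the sequence $\{a_k-a_{k+1}\}_{k=0}^{\infty}$ being non-increasing. *)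

(* Defs.v *)
From mathcomp Require Import all_boot all_order all_algebra.
From mathcomp Require Import all_classical all_reals all_analysis.

Set Implicit Arguments.
Unset Strict Implicit.
Unset Printing Implicit Defensive.

Import Order.TTheory GRing.Theory Num.Theory.
Import numFieldNormedType.Exports.

Local Open Scope ring_scope.
Local Open Scope classical_set_scope.

(* The norm [`|v|] that MathComp-Analysis puts on ['rV[R]_n] is the sup norm;
   it induces the right topology, hence the right notion of [differentiable],
   but Lipschitz constants have to be measured with the Euclidean norm. *)
Definition enorm (R : realType) (n : nat) (v : 'rV[R]_n) : R :=
  Num.sqrt (\sum_(i < n) v 0 i ^+ 2).

(* Only meaningful where [f] is differentiable: ['D_v] is total. *)
Definition gradient (R : realType) (n : nat) (f : 'rV[R]_n -> R^o)
    (x : 'rV[R]_n) : 'rV[R]_n :=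
  \row_(i < n) 'D_(delta_mx 0 i) f x.

Definition smooth (R : realType) (n : nat) (L : R) (f : 'rV[R]_n -> R^o) :
    Prop :=
  (forall x, differentiable f x) /\
  (forall x y, enorm (gradient f x - gradient f y) <= L * enorm (x - y)).

(* [Num.truncn t] is the floor of [t] for [0 <= t] and [0] otherwise, so this
   is the linear interpolation of the points [(k, a k)] on [[0, +oo[] only. *)
Definition interpolation (R : realType) (a : R^nat) (t : R) : R^o :=
  let k := Num.truncn t in a k + (t - k%:R) * (a k.+1 - a k).

Definition convex_sequence (R : realType) (a : R^nat) : Prop :=
  convex_function (`[0, +oo[ : set R^o) (interpolation a).

(* Main.v *)
Require Import Defs.
From mathcomp Require Import all_boot all_order all_algebra.
From mathcomp Require Import all_classical all_reals all_analysis.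
From mathcomp Require Import ring lra.

Import Order.TTheory GRing.Theory Num.Theory.
Import numFieldNormedType.Exports.

Local Open Scope ring_scope.
Local Open Scope classical_set_scope.

(* For a convex [L]-smooth [f] with gradients [g_i] at [x_i], the inequalities
     Q_ij : f x_i - f x_j - <g_j, x_i - x_j> - |g_i - g_j|^2 / (2 L) >= 0
   hold. As [f] is also [L']-smooth for every [L' >= L], one may assume
   [eta = 7 / (4 L)]. For consecutive iterates [x_0, x_1, x_2] one then has
     f x_0 - 2 f x_1 + f x_2 =
       (3/2) Q_01 + (1/2) Q_21 + (1/2) Q_20 + |g_0 + g_1 - 2 g_2|^2 / (8 L). *)

Section dot_product.
Context {R : realType} {n : nat}.
Implicit Types u v w : 'rV[R]_n.

Definition dot u v : R := \sum_(i < n) u 0 i * v 0 i.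

Lemma dotC u v : dot u v = dot v u.
Proof. by apply: eq_bigr => i _; rewrite mulrC. Qed.

Lemma dotDl u v w : dot (u + v) w = dot u w + dot v w.
Proof. by rewrite -big_split; apply: eq_bigr => i _; rewrite mxE mulrDl. Qed.

Lemma dotZl a u v : dot (a *: u) v = a * dot u v.
Proof. by rewrite mulr_sumr; apply: eq_bigr => i _; rewrite mxE mulrA. Qed.

Lemma dotNl u v : dot (- u) v = - dot u v.
Proof. by rewrite -scaleN1r dotZl mulN1r. Qed.

Lemma dotDr u v w : dot u (v + w) = dot u v + dot u w.
Proof. by rewrite dotC dotDl !(dotC u). Qed.

Lemma dotZr a u v : dot u (a *: v) = a * dot u v.
Proof. by rewrite dotC dotZl (dotC u). Qed.

Lemma dotNr u v : dot u (- v) = - dot u v.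
Proof. by rewrite dotC dotNl (dotC u). Qed.

Definition dotE := (dotDl, dotDr, dotNl, dotNr, dotZl, dotZr).

Lemma dot_ge0 u : 0 <= dot u u.
Proof. by apply: sumr_ge0 => i _; rewrite -expr2 sqr_ge0. Qed.

Lemma enormE u : enorm u = Num.sqrt (dot u u).
Proof. by congr Num.sqrt; apply: eq_bigr => i _; rewrite expr2. Qed.

(** Squaring turns Lipschitz bounds into inequalities between dot products, free of square roots. *)
Lemma enorm_le_dot a u v :
  enorm u <= a * enorm v -> dot u u <= a ^+ 2 * dot v v.
Proof.
move=> uav; rewrite -(sqr_sqrtr (dot_ge0 u)) -(sqr_sqrtr (dot_ge0 v)) -!enormE.
by rewrite -exprMn lerXn2r// nnegrE ?(le_trans _ uav)// enormE sqrtr_ge0.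
Qed.

(* A substitute for Cauchy-Schwarz: expand [|u - c v|^2 >= 0]. *)
Lemma dot_le_of_sqr c u v :
  0 < c -> dot u u <= c ^+ 2 * dot v v -> dot u v <= c * dot v v.
Proof.
move=> c0 uv; rewrite -(ler_pM2l c0).
by have := dot_ge0 (u - c *: v); rewrite !dotE (dotC v u); lra.
Qed.

End dot_product.

Section gradient.
Context {R : realType} {n : nat}.
Variable f : 'rV[R]_n -> R^o.
Implicit Types x y v : 'rV[R]_n.

Lemma derive_gradient x v :
  differentiable f x -> 'D_v f x = dot (gradient f x) v.
Proof.
move=> dfx; rewrite deriveE// [in LHS](row_sum_delta v) linear_sum.
by apply: eq_bigr => i _; rewrite linearZ /= mxE deriveE// mulrC.
Qed.

Lemma is_derive_line x v t : differentiable f (x + t *: v) ->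
  is_derive t 1 (fun s : R => f (x + s *: v)) (dot (gradient f (x + t *: v)) v).
Proof.
move=> dfx.
have lineE : (fun h : R => h^-1 *: (((fun s : R => f (x + s *: v)) \o shift t)
      (h *: 1) - f (x + t *: v))) =
    (fun h : R => h^-1 *: ((f \o shift (x + t *: v)) (h *: v) - f (x + t *: v))).
  apply/funext => h /=; congr (_ *: (f _ - _)).
  by rewrite [h *: 1]mulr1 scalerDl addrCA.
apply: DeriveDef; first by rewrite /derivable lineE; exact: diff_derivable.
by rewrite /derive lineE -derive_gradient.
Qed.

Lemma convex_gradient_le x y : convex_function (setT : set 'rV[R]_n) f ->
  differentiable f x -> f x + dot (gradient f x) (y - x) <= f y.
Proof.
move=> cf dfx; rewrite -lerBrDl -derive_gradient//.
have dv : derivable f x (y - x) by exact: diff_derivable.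
(* Convexity bounds the difference quotient by [f y - f x] only for [h] in (0, 1], so the derivative
   is read as a right-hand limit. *)
rewrite /derive cvg_at_rightE//; apply: limr_le.
  rewrite -(cvg_at_rightE (fun h : R => h^-1 *: ((f \o shift x) _ - f x)))//.
  apply: cvg_trans dv; apply: cvg_app.
  move=> A [e e0 Ae]; exists e => // h eh h0; apply: Ae => //.
  exact: lt0r_neq0.
near=> h.
have h0 : 0 < h by near: h; exact: nbhs_right_gt.
have h1 : h <= 1 by near: h; exact: nbhs_right_le.
rewrite /= [_ *: _]mulrC ler_pdivrMr//.
have : f (h *: y + (1 - h) *: x) <= h * f y + (1 - h) * f x :=
  cf (Itv01 (ltW h0) h1) y x (in_setT _) (in_setT _).
have -> : h *: y + (1 - h) *: x = h *: (y - x) + x.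
  by rewrite scalerBl scale1r scalerBr addrAC addrA.
move=> cfh; suff : f (h *: (y - x) + x) - f x <= h * (f y - f x) by rewrite mulrC.
by lra.
Unshelve. all: by end_near. Qed.

(** Descent lemma: [phi], which is [f] along the segment minus the linear and quadratic terms of the
    bound, has nonpositive slope at the mean value point, so [phi 1 <= phi 0]. *)
Lemma smooth_le L x v : 0 < L -> smooth L f ->
  f (x + v) <= f x + dot (gradient f x) v + L / 2 * dot v v.
Proof.
move=> L0 [df lipf]; set g := gradient f x.
pose phi (t : R) : R :=
  f (x + t *: v) - (t * dot g v + t ^+ 2 * (L / 2 * dot v v)).
pose dphi (t : R) : R :=
  dot (gradient f (x + t *: v)) v - (dot g v + t * L * dot v v).
have dphiE (t : R) : is_derive t (1:R) phi (dphi t).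
  have dl := is_derive_line x v t (df _).
  have dq : is_derive t (1:R)
      (fun s : R => s * dot g v + s ^+ 2 * (L / 2 * dot v v))
      (dot g v + t * L * dot v v).
    apply: is_derive_eq; rewrite !scaler0 !add0r /GRing.scale /=.
    by field.
  exact: is_deriveB.
have phi_cont : {within `[0, 1], continuous phi}.
  by apply: derivable_within_continuous => t _; apply: ex_derive.
have [c /[!in_itv] /= /andP[c0 c1]] := MVT ltr01 (fun t _ => dphiE t) phi_cont.
rewrite subr0 mulr1 /phi scale1r scale0r addr0 => phic.
have Lc0 : 0 < L * c by exact: mulr_gt0.
(* The gradient varies by at most [L * c * |v|] between [x] and [x + c *: v]; pairing this variation
   with [v] costs one more factor [|v|]. *)
have dphi_le0 : dphi c <= 0.
  have := lipf (x + c *: v) x; rewrite addrAC subrr add0r.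
  move=> /enorm_le_dot; rewrite dotZl dotZr [c * _]mulrA -expr2 mulrA -exprMn.
  move=> /(dot_le_of_sqr _ _ _ Lc0); rewrite dotDl dotNl /dphi.
  by lra.
by lra.
Qed.

(** At [x - L^-1 *: d], the quadratic upper bound from [x] is compared with the tangent plane at
    [y], which lies below [f]. This point minimises the gap between the two bounds. *)
Lemma convex_smooth_le L x y : 0 < L -> smooth L f ->
  convex_function (setT : set 'rV[R]_n) f ->
  f y + dot (gradient f y) (x - y)
    + dot (gradient f x - gradient f y) (gradient f x - gradient f y) / (2 * L)
  <= f x.
Proof.
move=> L0 sf cf; set d := gradient f x - gradient f y.
have := smooth_le L x (- (L^-1 *: d)) L0 sf.
have := convex_gradient_le y (x - L^-1 *: d) cf (sf.1 y).
rewrite addrAC {}/d.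
move: (gradient f x) (gradient f y) (x - y) => g h v.
(* Written as [|d|^2 / L - |d|^2 / (2 L)], in the very terms of the two bounds, so that the rest is
   linear. *)
have -> : dot (g - h) (g - h) / (2 * L) = L^-1 * dot g (g - h)
    - L^-1 * dot h (g - h) - L / 2 * (L^-1 * (L^-1 * dot (g - h) (g - h))).
  rewrite -mulrBr -dotNl -dotDl; field; exact: lt0r_neq0.
by move: (g - h) => d; rewrite dotDr !dotNl !dotNr !dotZl !dotZr; lra.
Qed.
End gradient.

Lemma gradient_step_convex {R : realType} {n : nat} (f : 'rV[R]_n -> R^o)
    (L eta : R) x0 x1 x2 :
  0 < L -> smooth L f -> convex_function (setT : set 'rV[R]_n) f ->
  0 < eta -> eta <= (7 / 4) / L ->
  x1 = x0 - eta *: gradient f x0 -> x2 = x1 - eta *: gradient f x1 ->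
  f x1 - f x2 <= f x0 - f x1.
Proof.
move=> L0 [df lipf] cf eta0 etaL x1E x2E.
(* [7 / 4 / eta] is the constant, at least [L], for which [eta] is the extreme step size. *)
have sf : smooth (7 / 4 / eta) f.
  split=> // x y; apply: (le_trans (lipf x y)); apply: ler_wpM2r.
    by rewrite enormE sqrtr_ge0.
  by rewrite ler_pdivlMr// mulrC -ler_pdivlMr.
have L'0 : 0 < 7 / 4 / eta by rewrite divr_gt0.
have := convex_smooth_le f (7 / 4 / eta) x0 x1 L'0 sf cf.
have := convex_smooth_le f (7 / 4 / eta) x2 x1 L'0 sf cf.
have := convex_smooth_le f (7 / 4 / eta) x2 x0 L'0 sf cf.
move: (f x0) (f x1) (f x2) (gradient f x0) (gradient f x1) (gradient f x2)
  x1E x2E => f0 f1 f2 g0 g1 g2 x1E x2E.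
have -> : x2 - x0 = - (eta *: g0) - eta *: g1.
  by rewrite x2E x1E addrAC (addrAC x0) subrr add0r.
have -> : x2 - x1 = - (eta *: g1) by rewrite x2E addrAC subrr add0r.
have -> : x0 - x1 = eta *: g0 by rewrite x1E opprB addrCA subrr addr0.
have dsE z : z / (2 * (7 / 4 / eta)) = eta * z * (2 / 7).
  by field; exact: lt0r_neq0.
(* The square that closes the identity; its weight there is [eta / 14]. *)
have := mulr_ge0 (ltW eta0) (dot_ge0 (g0 + g1 - 2 *: g2)).
rewrite !dsE !dotE (dotC g1 g0) (dotC g2 g0) (dotC g2 g1).
by lra.
Qed.

Lemma convex_sequence_nonincreasing {R : realType} (a : R^nat) :
  nonincreasing_seq (fun k => a k - a k.+1) -> convex_sequence a.
Proof.
move=> da; pose tangent k (t : R) := a k + (t - k%:R) * (a k.+1 - a k).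
(* Induction away from [k] in both directions: the slope of [tangent k] is at most every later
   increment of [a] and at least every earlier one. *)
have tangent_nat k m : tangent k m%:R <= a m.
  have [km|/ltnW mk] := leqP k m.
    rewrite -(subnK km); elim: (m - k)%N => [|j IH].
      by rewrite add0n /tangent subrr mul0r addr0.
    move: IH (da k (j + k)%N (leq_addl _ _)).
    by rewrite /tangent addSn -(natr1 (j + k)%N); lra.
  rewrite -(subKn mk); have : (k - m <= k)%N by exact: leq_subr.
  elim: (k - m)%N => [|j IH] jk.
    by rewrite subn0 /tangent subrr mul0r addr0.
  move: (IH (ltnW jk)) (da _ _ (leq_subr j.+1 k)).
  rewrite -(subnSK jk) /tangent -(natr1 (k - j.+1)%N).
  by lra.
have interpolationE t : interpolation a t = tangent (Num.truncn t) t by [].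
(* [interpolation a] is the supremum of the affine functions [tangent k]. *)
have tangent_le k t : 0 <= t -> tangent k t <= interpolation a t.
  move=> t0; rewrite interpolationE; set m := Num.truncn t.
  have /andP[mt tm] := truncn_itv t0.
  (* Both sides are affine on [[m, m + 1]], so comparing them at the two endpoints suffices. *)
  have := tangent_nat k m; have := tangent_nat k m.+1; move: mt tm.
  rewrite -/m /tangent -(natr1 m).
  by nra.
move=> t u v; rewrite !inE /= !in_itv /= !andbT => u0 v0.
set w := (X in interpolation a X).
have wE : w = t%:num * u + (1 - t%:num) * v by [].
(* The tangent that agrees with the interpolation at [w] is affine, so it splits over the convex
   combination. *)
have -> : interpolation a w = t%:num * tangent (Num.truncn w) u
    + (1 - t%:num) * tangent (Num.truncn w) v.
  by rewrite interpolationE {2}wE /tangent; ring.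
by apply: lerD; apply: ler_wpM2l; rewrite ?tangent_le.
Qed.

Theorem theorem1 (R : realType) (n : nat) (L : R) (L_gt0 : 0 < L)
    (f : 'rV[R]_n -> R^o)
    (f_convex : convex_function (setT : set 'rV[R]_n) f)
    (f_smooth : smooth L f)
    (eta : R) (eta_gt0 : 0 < eta) (eta_le : eta <= (7 / 4) / L)
    (x : nat -> 'rV[R]_n)
    (x_gd : forall k : nat, x k.+1 = x k - eta *: gradient f (x k)) :
  convex_sequence (fun k => f (x k)) /\
  nonincreasing_seq (fun k => f (x k) - f (x k.+1)).
Proof.
have decr : nonincreasing_seq (fun k => f (x k) - f (x k.+1)).
  by apply/nonincreasing_seqP => k; apply: (@gradient_step_convex R n f L eta).
by split => //; exact: convex_sequence_nonincreasing.
Qed.
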